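(* For every integer $n\ge3$, $$P_n^{\text{av}(123)}\big(W_{\mathcal{S}(n,0)}\big)=P_n^{\text{av}(123)}(\sigma_1=n)=\frac{C_{n-1}}{C_n},$$ $$P_n^{\text{av}(123)}\big(W_{\mathcal{S}(n,M)}\big)=P_n^{\text{av}(123)}\big(n\in\{\sigma_{M+1},\dots,\sigma_n\}\big),\quad M\in\{1,\dots,n-1\}.$$ In particular, the optimal probability, that is, $\max_{M\in\{0,\dots,n-1\}}P_n^{\text{av}(123)}(W_{\mathcal{S}(n,M)})$, occurs for $M=1$ and is increasing in $n$. One has $$P_n^{\text{av}(123)}\big(W_{\mathcal{S}(n,1)}\big)=P_n^{\text{av}(123)}(\sigma_1\ne n)=1-\frac{C_{n-1}}{C_n}$$ and $$\lim_{n\to\infty}P_n^{\text{av}(123)}\big(W_{\mathcal{S}(n,1)}\big)=\frac34.$$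
   Context: $S_n$ is the set of permutations $\sigma=\sigma_1\cdots\sigma_n$ of $[n]=\{1,\dots,n\}$. In the secretary problem, $n$ items with ranks $1,\dots,n$ arrive one at a time, $\sigma_i$ being the rank of the $i$th item to arrive; $n$ is the highest rank. The observer sees only the relative ranks of the items that have arrived so far. For $M\in\{0,1,\dots,n-1\}$, the strategy $\mathcal{S}(n,M)$ is: reject the first $M$ items, then select the first later-arriving item whose rank is higher than that of each of the first $M$ items, if such an item exists (for $M=0$, this means the first item is selected). $W_{\mathcal{S}(n,M)}\subset S_n$ is the event that the observer using $\mathcal{S}(n,M)$ selects the item of rank $n$. Pattern avoidance: for $\eta=\eta_1\eta_2\eta_3\in S_3$ and $\sigma\in S_n$, $\sigma$ contains $\eta$ if there are indices $1\le i_1<i_2<i_3\le n$ such that for all $1\le j,k\le 3$, $\sigma_{i_j}<\sigma_{i_k}$ if and only if $\eta_j<\eta_k$; otherwise $\sigma$ avoids $\eta$. $S_n^{\text{av}(\eta)}$ is the set of $\sigma\in S_n$ avoiding $\eta$, and $P_n^{\text{av}(\eta)}$ is the uniform probability measure on $S_n^{\text{av}(\eta)}$. $C_n=\frac{1}{n+1}\binom{2n}{n}$ for $n\ge1$ and $C_0=1$ (Catalan numbers). *)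

(* Defs.v *)
From HB Require Import structures.
From mathcomp Require Import all_boot all_order all_algebra all_fingroup.
From mathcomp Require Import all_classical all_reals all_analysis.

Set Implicit Arguments.
Unset Strict Implicit.
Unset Printing Implicit Defensive.

Import Order.TTheory GRing.Theory Num.Theory.
Import numFieldNormedType.Exports.

Local Open Scope nat_scope.


(* The word sigma_1 ... sigma_n of a permutation, with ranks in {1, ..., n}:
   ['S_n] permutes {0, ..., n-1}, hence the shift. The entry of index i
   (counted from 0) is sigma_(i+1). *)
Definition word n (s : 'S_n) : seq nat := [seq (s i : nat).+1 | i <- enum 'I_n].

(* Conditions on ranks and on 0-based values agree, since only the order of the
   entries matters here. *)
Definition contains n (eta : 'S_3) (s : 'S_n) : bool :=
  [exists i : {ffun 'I_3 -> 'I_n},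
    [forall j : 'I_3, forall k : 'I_3, (j < k) ==> (i j < i k)] &&
    [forall j : 'I_3, forall k : 'I_3, (s (i j) < s (i k)) == (eta j < eta k)]].

Definition avoiders n (eta : 'S_3) : {set 'S_n} :=
  [set s : 'S_n | ~~ contains eta s]%SET.

Definition pat123 : 'S_3 := 1%g.

(* Rank selected by the strategy S(n, M) on the word w, if any. For M = 0 the
   condition on [take M w] is void, so the first item is selected. *)
Definition selected (M : nat) (w : seq nat) : option nat :=
  ohead [seq x <- drop M w | all (fun y => y < x) (take M w)].

Definition win n (M : nat) : {set 'S_n} :=
  [set s : 'S_n | selected M (word s) == Some n]%SET.

Local Open Scope ring_scope.

Definition Pav (R : realType) (eta : 'S_3) n (E : {set 'S_n}) : R :=
  #|(E :&: avoiders n eta)%SET|%:R / #|avoiders n eta|%:R.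

(* Probabilities are nonnegative, so 0 is harmless as the default value. *)
Definition optimal_prob (R : realType) (eta : 'S_3) (n : nat) : R :=
  \big[Num.max/0]_(M < n) Pav R eta (win n M).

Definition catalan (R : realType) (n : nat) : R :=
  'C(2 * n, n)%:R / n.+1%:R.

(* Main.v *)
Require Import Defs.
From HB Require Import structures.
From mathcomp Require Import all_boot all_order all_algebra all_fingroup.
From mathcomp Require Import all_classical all_reals all_analysis.
From mathcomp Require Import zify ring lra.

Set Implicit Arguments.
Unset Strict Implicit.
Unset Printing Implicit Defensive.

Import Order.TTheory GRing.Theory Num.Theory.
Import numFieldNormedType.Exports.

Local Open Scope classical_set_scope.
Local Open Scope ring_scope.

(** The proof rests on two observations.

    The first is that, on a 123-avoiding permutation, a strategy with
    [0 < M] wins whenever [n] has not been rejected. If the selected item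
    [x] were not [n], then the first item, [x] and [n] would form a 123: [x]
    beats every rejected item, in particular the first one, and [n] comes
    after [x] since [n] itself qualifies for selection. So winning means
    that [n] lies beyond position [M] ([mem_win]), which is most likely for
    [M = 1], among the positive [M]; there the losing event is that [n] comes
    first, which is exactly the winning event of [M = 0].

    The second is a count. Write a permutation of size [n + 1], with values
    counted from 0, as a first value [a] followed by a permutation of pattern
    [t]. It avoids 123 iff [t] does and the later values exceeding [a], which
    are the values at least [a] of [t], appear in decreasing order. Hence the
    numbers [B n c] of avoiders whose values at least [c] decrease satisfy the
    ballot recurrence [B (n + 1) c = B n 0 + ... + B n c] for [c <= n], and
    [B n c = 'C(n + c, n) - 'C(n + c, n + 1)] ([card_dec_avoiders]). The case
    [c = n] gives the Catalan numbers, while [a = n] imposes nothing on [t],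
    so that in size [n] the top rank comes first with probability
    [C_(n-1) / C_n = (n + 1) / (4 n - 2)]. This ratio is at most [1 / 2] for
    [2 <= n], whence [M = 1] beats [M = 0], and it decreases strictly to
    [1 / 4], whence the monotonicity and the limit [3 / 4]. *)

(** * Avoidance and insertion of a first value *)

Lemma avoidersP n (s : 'S_n) :
  reflect (forall i j k : 'I_n,
             (i < j)%N -> (j < k)%N -> (s i < s j)%N -> ~~ (s j < s k)%N)
          (s \in avoiders n pat123).
Proof.
rewrite inE; apply: (iffP idP) => [/existsPn av i j k ij jk sij | av].
  apply/negP => sjk; have /negP := av [ffun x : 'I_3 => nth i [:: i; j; k] x].
  have ik := ltn_trans ij jk; have sik := ltn_trans sij sjk.
  apply; apply/andP; split; apply/'forall_forallP => -[[|[|[|x]]] //= ?];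
    case=> [[|[|[|y]]] //= ?]; rewrite !ffunE ?perm1 /= //; apply/eqP; lia.
apply/existsPn => f; apply/negP => /andP[/'forall_forallP mono].
move=> /'forall_forallP pat.
pose a : 'I_3 := Ordinal (isT : (0 < 3)%N).
pose b : 'I_3 := Ordinal (isT : (1 < 3)%N).
pose c : 'I_3 := Ordinal (isT : (2 < 3)%N).
have /eqP sab := pat a b; have /eqP sbc := pat b c.
rewrite !perm1 /= in sab sbc.
by have := av _ _ _ (mono a b) (mono b c) sab; rewrite sbc.
Qed.

Definition decreasing_from n (c : nat) (s : 'S_n) : bool :=
  [forall i : 'I_n, forall j : 'I_n,
     (i < j)%N && (c <= s i)%N ==> (s j < s i)%N].

Lemma decreasing_fromP n c (s : 'S_n) :
  reflect (forall i j : 'I_n, (i < j)%N -> (c <= s i)%N -> (s j < s i)%N)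
          (decreasing_from c s).
Proof.
apply: (iffP 'forall_forallP) => dec i j.
  by move=> ij ci; have /implyP := dec i j; apply; rewrite ij.
by apply/implyP => /andP[]; apply: dec.
Qed.

(** At most one value is then at least [c], namely the largest one. *)
Lemma decreasing_from_pred_size n c (s : 'S_n) :
  (n <= c.+1)%N -> decreasing_from c s.
Proof.
move=> nc; apply/decreasing_fromP => i j ij ci; rewrite ltn_neqAle andbC.
rewrite (leq_trans _ ci) /=; last by rewrite -ltnS (leq_trans _ nc).
by apply/eqP => /val_inj/perm_inj eij; rewrite eij ltnn in ij.
Qed.

Lemma ltn_lift n (h : 'I_n.+1) (i j : 'I_n) :
  (lift h i < lift h j)%N = (i < j)%N.
Proof. by rewrite !ltnNge leq_bump2. Qed.

(** A new 123 must use the new first value [a] as its 1, so its 2 and 3 are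
    an ascent of [t] between values that lie above [a] after insertion, that
    is, values at least [a] in [t]. *)
Lemma lift_perm0_avoids n (a : 'I_n.+1) (t : 'S_n) :
  (lift_perm ord0 a t \in avoiders n.+1 pat123)
    = (t \in avoiders n pat123) && decreasing_from a t.
Proof.
apply/avoidersP/andP => [av | [/avoidersP av /decreasing_fromP dec] i j k].
  split; [apply/avoidersP => i j k ij jk | apply/decreasing_fromP => i j ij ai].
    have := av (lift ord0 i) (lift ord0 j) (lift ord0 k).
    by rewrite !lift_perm_lift !ltn_lift; apply.
  (* An ascent of [t] from [t i] would make a 123 with the first value. *)
  have := av ord0 (lift ord0 i) (lift ord0 j) isT.
  rewrite lift_perm_id !lift_perm_lift !ltn_lift ij -leqNgt.
  have -> : (a < lift a (t i))%N by rewrite /= /bump ai add1n ltnS.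
  move=> /(_ isT isT); rewrite leq_eqVlt => /orP[/eqP/val_inj/perm_inj eij|//].
  by rewrite eij ltnn in ij.
case: (unliftP ord0 k) => [k'|] -> //.
case: (unliftP ord0 j) => [j'|] -> //.
case: (unliftP ord0 i) => [i'|] ->.
  by rewrite !lift_perm_lift !ltn_lift; apply: av.
rewrite lift_perm_id !lift_perm_lift !ltn_lift -leqNgt => _ jk aj.
apply/ltnW/dec => //; move: aj; rewrite /= /bump.
by case: leqP => //; lia.
Qed.

Lemma decreasing_from_lift_max n c (t : 'S_n) : (c <= n)%N ->
  decreasing_from c (lift_perm ord0 ord_max t) = decreasing_from c t.
Proof.
move=> cn; apply/decreasing_fromP/decreasing_fromP => dec i j.
  have := dec (lift ord0 i) (lift ord0 j).
  by rewrite !lift_perm_lift !ltn_lift lift_max.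
case: (unliftP ord0 j) => [j'|] -> //.
case: (unliftP ord0 i) => [i'|] ->.
  by rewrite !lift_perm_lift !ltn_lift lift_max; apply: dec.
by rewrite lift_perm_id lift_perm_lift lift_max.
Qed.

(** A first value [a] other than the maximum [n] starts an ascent to [n], so it
    must lie below the threshold [c]. The values at least [c] then come from
    values at least [a] in [t], which already decrease. *)
Lemma decreasing_from_lift n c (a : 'I_n.+1) (t : 'S_n) :
  (a < n)%N -> decreasing_from a t ->
  decreasing_from c (lift_perm ord0 a t) = (a < c)%N.
Proof.
case: n a t => [|n] a t an; first by rewrite ltn0 in an.
move=> /decreasing_fromP dec; apply/decreasing_fromP/idP => [dec' | ac i j].
  rewrite ltnNge; apply/negP => ca.
  (* The new maximum [n.+1] is the image of the maximum of [t], as [a] is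
     smaller, and it follows the first value. *)
  have := dec' ord0 (lift ord0 ((t^-1)%g ord_max)) isT.
  rewrite lift_perm_id lift_perm_lift permKV => /(_ ca).
  by rewrite /= /bump; move: an; lia.
case: (unliftP ord0 j) => [j'|] -> //.
case: (unliftP ord0 i) => [i'|] ->.
  rewrite !lift_perm_lift !ltn_lift => ij ci; apply: dec => //.
  by move: ci; rewrite /= /bump; lia.
by rewrite lift_perm_id => _; rewrite leqNgt ac.
Qed.

(** * Counting the avoiders *)

(** Decomposition of permutations by first value; injectivity suffices,
    since both sides have [n.+1`!] elements. *)
Lemma card_lift_perm0 n (P : pred 'S_n.+1) :
  #|[set s | P s]%SET|
    = (\sum_(a < n.+1) #|[set t : 'S_n | P (lift_perm ord0 a t)]%SET|)%N.
Proof.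
pose f (u : 'I_n.+1 * 'S_n) : 'S_n.+1 := lift_perm ord0 u.1 u.2.
have f_inj : injective f.
  move=> [a t] [b u] /= /permP e.
  have ab : a = b by have := e ord0; rewrite !lift_perm_id.
  subst b; congr (_, _); apply/permP => i.
  by have := e (lift ord0 i); rewrite !lift_perm_lift => /lift_inj.
have f_bij : bijective f.
  by apply: inj_card_bij f_inj _; rewrite card_prod !card_Sn card_ord factS.
rewrite -sum1dep_card (reindex f) ?big_mkcond; last exact: onW_bij.
rewrite -(pair_bigA _ (fun a t => if P (lift_perm ord0 a t) then 1 else 0)%N) /=.
by apply: eq_bigr => a _; rewrite -sum1dep_card -big_mkcond.
Qed.

Definition dec_avoiders n (c : nat) : {set 'S_n} :=
  [set s in avoiders n pat123 | decreasing_from c s]%SET.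

Lemma in_dec_avoiders n c (s : 'S_n) :
  (s \in dec_avoiders n c) = (s \in avoiders n pat123) && decreasing_from c s.
Proof. by rewrite finset.in_set. Qed.

(** The ballot recurrence. The leading maximum contributes the term [a = c] of
    the sum, since it leaves the threshold [c] unchanged; a leading value
    [a < c] contributes the term [a], and the other first values nothing. *)
Lemma card_dec_avoidersS n c : (c <= n)%N ->
  #|dec_avoiders n.+1 c| = (\sum_(a < c.+1) #|dec_avoiders n a|)%N.
Proof.
move=> cn; rewrite card_lift_perm0 big_ord_recr [RHS]big_ord_recr /=.
congr (_ + _)%N; last first.
  apply: eq_card => t; rewrite finset.in_set in_dec_avoiders lift_perm0_avoids.
  by rewrite decreasing_from_lift_max // decreasing_from_pred_size ?andbT.
rewrite (big_ord_widen n (fun a => #|dec_avoiders n a|) cn) [RHS]big_mkcond.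
apply: eq_bigr => a _; case: ifP => ac.
  apply: eq_card => t; rewrite finset.in_set in_dec_avoiders lift_perm0_avoids.
  rewrite -andbA; case: (boolP (decreasing_from _ t)) => //= d.
  by rewrite decreasing_from_lift ?ac //=.
apply/eqP; rewrite cards_eq0; apply/eqP/setP => t.
rewrite finset.in_set finset.in_set0 lift_perm0_avoids.
by apply/negP => /andP[/andP[_ d]]; rewrite decreasing_from_lift //= ac.
Qed.

Lemma dec_avoiders_all n c : (n <= c.+1)%N ->
  dec_avoiders n c = avoiders n pat123.
Proof.
move=> nc; apply/setP => s.
by rewrite in_dec_avoiders decreasing_from_pred_size ?andbT.
Qed.

(** For [c <= n] Pascal's rule turns the recurrence into the hockey-stick
    summation. The threshold [c = n.+1] in size [n.+1] falls outside the
    recurrence, but it gives the same set as [c = n], and the two closed forms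
    agree by the symmetry of ['C(2 * n + 1, _)]. *)
Lemma card_dec_avoiders n c : (c <= n)%N ->
  (#|dec_avoiders n c| + 'C(n + c, n.+1) = 'C(n + c, n))%N.
Proof.
elim: n c => [|n IHn] c.
  rewrite leqn0 => /eqP ->; rewrite dec_avoiders_all //= bin0 bin0n addn0.
  apply/eqP/cards1P; exists 1%g; apply/setP => s; rewrite finset.in_set1.
  have -> : s = 1%g by apply/permP => -[].
  by rewrite eqxx; apply/avoidersP => -[].
have IHc d : (d <= n)%N ->
    (#|dec_avoiders n.+1 d| + 'C(n.+1 + d, n.+2) = 'C(n.+1 + d, n.+1))%N.
  elim: d => [|d IHd] dn; rewrite card_dec_avoidersS //.
    have := IHn 0%N dn; rewrite big_ord1 !addn0 !binn /=.
    by rewrite (bin_small (ltnSn n)) (bin_small (ltnSn n.+1)) addn0.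
  rewrite big_ord_recr -(card_dec_avoidersS (ltnW dn)) /=.
  have := IHn _ dn; have := IHd (ltnW dn); rewrite !addnS !addSn !(binS _.+1).
  by move=> e1 e2; rewrite addnACA e1 e2.
rewrite leq_eqVlt => /orP[/eqP -> | /IHc //].
have := IHc n (leqnn n); rewrite !dec_avoiders_all // !addnS !addSn !(binS _.+1).
suff -> : 'C((n + n).+1, n) = 'C((n + n).+1, n.+1).
  by move=> e; rewrite addnA e.
by rewrite -[RHS]bin_sub; [congr 'C(_, _) | ]; lia.
Qed.

Lemma card_avoiders n : (#|avoiders n pat123| * n.+1 = 'C(2 * n, n))%N.
Proof.
have := card_dec_avoiders (leqnn n); rewrite dec_avoiders_all // addnn -mul2n.
have := mul_bin_left (2 * n) n; have -> : (2 * n - n = n)%N by lia.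
nia.
Qed.

(** A leading maximum is never part of a 123. *)
Lemma card_avoiders_head n :
  #|[set s in avoiders n.+1 pat123 | s ord0 == ord_max]%SET|
    = #|avoiders n pat123|.
Proof.
rewrite card_lift_perm0 big_ord_recr /= big1 ?add0n => [|a _].
  apply: eq_card => t; rewrite finset.in_set lift_perm0_avoids lift_perm_id eqxx andbT.
  by rewrite decreasing_from_pred_size ?andbT.
apply/eqP; rewrite cards_eq0; apply/eqP/setP => t.
by rewrite finset.in_set finset.in_set0 lift_perm_id -val_eqE /= ltn_eqF ?andbF.
Qed.

(** * Winning on an avoider *)

Lemma size_word n (s : 'S_n) : size (word s) = n.
Proof. by rewrite size_map size_enum_ord. Qed.

Lemma nth_word n (s : 'S_n) (i : 'I_n) : nth 0%N (word s) i = (s i).+1.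
Proof. by rewrite (nth_map i) ?size_enum_ord // nth_ord_enum. Qed.

Lemma word_uniq n (s : 'S_n) : uniq (word s).
Proof.
rewrite map_inj_uniq ?enum_uniq // => i j [] /val_inj; exact: perm_inj.
Qed.

Lemma mem_word n (s : 'S_n) x : (x \in word s) = (0 < x <= n)%N.
Proof.
apply/mapP/andP => [[i _ ->] // | [x0 xn]].
have xn' : (x.-1 < n)%N by rewrite prednK.
exists ((s^-1)%g (Ordinal xn')); first by rewrite mem_enum.
by rewrite permKV /= prednK.
Qed.

Lemma head_word n (s : 'S_n.+1) :
  (head 0%N (word s) == n.+1) = (s ord0 == ord_max).
Proof. by rewrite -nth0 (nth_word s ord0) eqSS. Qed.

Lemma ohead_filter (T : Type) (x0 : T) (P : pred T) (l : seq T) :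
  has P l -> ohead (seq.filter P l) = Some (nth x0 l (find P l)).
Proof. by elim: l => //= x l IHl; case: (P x). Qed.

Lemma mem_win0 n (s : 'S_n) :
  (0 < n)%N -> (s \in win n 0) = (head 0%N (word s) == n).
Proof.
rewrite finset.in_set /selected take0 drop0 filter_predT.
by have := size_word s; case: (word s) => [|x w] <-.
Qed.

(** If an item [x] other than [n] were selected, then [n], which also beats
    all rejected items, would come after [x]; together with the first item,
    rejected because [0 < M], they would form a 123. *)
Lemma mem_win n M (s : 'S_n) : (0 < M)%N -> s \in avoiders n pat123 ->
  (s \in win n M) = (n \in drop M (word s)).
Proof.
move=> M0 /avoidersP av; rewrite finset.in_set /selected.
set w := word s; set P := fun x => all _ _.
apply/eqP/idP => [sel | nD].
  have : n \in seq.filter P (drop M w).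
    by case: (seq.filter _ _) sel => //= x r [->]; rewrite mem_head.
  by rewrite mem_filter => /andP[].
have Pn : P n.
  apply/allP => y yT; have := word_uniq s.
  rewrite -/w -(cat_take_drop M w) cat_uniq => /and3P[_ /hasPn dis _].
  have := mem_take yT; rewrite mem_word => /andP[_ yn].
  rewrite ltn_neqAle yn andbT; apply: contraTneq yT => ->; exact: dis.
have hasP : has P (drop M w) by apply/hasP; exists n.
rewrite (ohead_filter 0%N hasP); congr Some.
set f := find P _; pose m := index n (drop M w).
have fm : (f <= m)%N.
  rewrite leqNgt; apply/negP => /(before_find 0%N).
  by rewrite nth_index // Pn.
(* [M + f] and [M + m] are the positions in the word of the selected item
   and of [n]. *)
have [ltfm | gtfm | ->] := ltngtP f m; last by rewrite nth_index.
  have kn : (M + m < n)%N.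
    have : (m < size (drop M w))%N by rewrite index_mem.
    by rewrite size_drop size_word ltn_subRL.
  have jn : (M + f < n)%N by apply: leq_ltn_trans kn; rewrite leq_add2l ltnW.
  have i0 : (0 < n)%N by apply: leq_ltn_trans kn.
  have Pf : P (nth 0%N (drop M w) f) by apply: nth_find.
  have wi := nth_word s (Ordinal i0); have wj := nth_word s (Ordinal jn).
  have wk := nth_word s (Ordinal kn).
  have jk : (Ordinal jn < Ordinal kn)%N by rewrite /= ltn_add2l.
  rewrite /= -/w -?nth_drop in wi wj wk; rewrite nth_index // in wk.
  have sij : (s (Ordinal i0) < s (Ordinal jn))%N.
    rewrite -ltnS -wi -wj; apply: (allP Pf).
    rewrite -(nth_take 0%N M0) mem_nth // size_take size_word.
    by case: ifP.
  have := av (Ordinal i0) (Ordinal jn) (Ordinal kn).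
  rewrite jk sij /= addn_gt0 M0 => /(_ isT isT isT) /negP; case.
  rewrite ltn_neqAle -[(_ <= _)%N]ltnS -wk ltn_ord andbT.
  by apply: contraTneq jk => /val_inj/perm_inj ->; rewrite ltnn.
by rewrite ltnNge fm in gtfm.
Qed.

Lemma mem_drop1_word n (s : 'S_n) : (0 < n)%N ->
  (n \in drop 1 (word s)) = (head 0%N (word s) != n).
Proof.
move=> n0; have := word_uniq s; have := mem_word s n; rewrite n0 leqnn.
case: (word s) => //= x w; rewrite drop0 in_cons eq_sym.
by case: eqVneq => //= -> _ /andP[/negPf].
Qed.

(** * Probabilities *)

Lemma card_avoiders_gt0 n : (0 < #|avoiders n pat123|)%N.
Proof.
have : (0 < 'C(2 * n, n))%N by rewrite bin_gt0 leq_pmull.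
by rewrite -card_avoiders muln_gt0 => /andP[].
Qed.

Lemma catalan_avoiders (R : realType) n :
  catalan R n = #|avoiders n pat123|%:R.
Proof. by rewrite /catalan -card_avoiders natrM mulfK ?pnatr_eq0. Qed.

(** The relation [(n + 2) C_(n+1) = (4 n + 2) C_n], on natural numbers. *)
Lemma card_avoidersS n :
  (n.+2 * #|avoiders n.+1 pat123| = (4 * n + 2) * #|avoiders n pat123|)%N.
Proof.
have e1 := card_avoiders n.+1; have e0 := card_avoiders n.
have b1 := mul_bin_diag (2 * n.+1) n.
have b0 := mul_bin_diag (2 * n).+1 n.
have sym : 'C((2 * n).+1, n) = 'C((2 * n).+1, n.+1).
  by rewrite -[RHS]bin_sub; [congr 'C(_, _) | ]; lia.
have e2 : (2 * n.+1 = (2 * n).+2)%N by lia.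
rewrite e2 /= in e1 b1 b0; rewrite sym in b1.
apply/eqP; rewrite -(eqn_pmul2r (isT : (0 < n.+1)%N)).
rewrite [(n.+2 * _)%N]mulnC e1 -[X in _ == X]mulnA e0; apply/eqP.
rewrite mulnC -b1.
transitivity (2 * (n.+1 * 'C((2 * n).+1, n.+1)))%N.
  by rewrite mulnA; congr (_ * _)%N; lia.
by rewrite -b0 mulnA; congr (_ * _)%N; lia.
Qed.

Lemma catalan_ratio (R : realType) n :
  catalan R n / catalan R n.+1 = n.+2%:R / (4 * n + 2)%:R.
Proof.
apply/eqP; rewrite !catalan_avoiders eqr_div ?addn2;
  rewrite ?pnatr_eq0 -?lt0n ?card_avoiders_gt0 //.
by rewrite -!natrM card_avoidersS addn2 mulnC.
Qed.

Lemma eq_Pav (R : realType) n (E F : {set 'S_n}) :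
  (forall s, s \in avoiders n pat123 -> (s \in E) = (s \in F)) ->
  Pav R pat123 E = Pav R pat123 F.
Proof.
move=> EF; congr (_%:R / _); apply: eq_card => s; rewrite !finset.in_setI.
by case: (boolP (s \in avoiders _ _)) => [/EF -> //|]; rewrite !andbF.
Qed.

Lemma le_Pav (R : realType) n (E F : {set 'S_n}) : E \subset F ->
  Pav R pat123 E <= Pav R pat123 F.
Proof.
by move=> EF; rewrite ler_wpM2r ?invr_ge0 // ler_nat subset_leq_card ?finset.setSI.
Qed.

Lemma Pav_setC (R : realType) n (E : {set 'S_n}) :
  Pav R pat123 (~: E)%SET = 1 - Pav R pat123 E.
Proof.
apply/eqP; rewrite eq_sym subr_eq -mulrDl -natrD.
rewrite finset.setIC -finset.setDE finset.setIC addnC cardsID divff //.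
by rewrite pnatr_eq0 -lt0n card_avoiders_gt0.
Qed.

Lemma Pav_head_max (R : realType) n :
  Pav R pat123 [set s : 'S_n.+1 | head 0%N (word s) == n.+1]%SET
    = catalan R n / catalan R n.+1.
Proof.
rewrite !catalan_avoiders -card_avoiders_head; congr (_%:R / _).
by apply: eq_card => s; rewrite finset.in_setI !finset.in_set head_word andbC.
Qed.

Lemma Pav_win0 (R : realType) n : (0 < n)%N ->
  Pav R pat123 (win n 0)
    = Pav R pat123 [set s : 'S_n | head 0%N (word s) == n]%SET.
Proof. by move=> n0; apply: eq_Pav => s _; rewrite mem_win0 ?finset.in_set. Qed.

Lemma Pav_win (R : realType) n M : (0 < M)%N ->
  Pav R pat123 (win n M)
    = Pav R pat123 [set s : 'S_n | n \in drop M (word s)]%SET.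
Proof.
by move=> M0; apply: eq_Pav => s av; rewrite mem_win // finset.in_set.
Qed.

Lemma Pav_win1 (R : realType) n :
  Pav R pat123 (win n.+1 1)
    = Pav R pat123 [set s : 'S_n.+1 | head 0%N (word s) != n.+1]%SET.
Proof.
rewrite Pav_win //; apply: eq_Pav => s _.
by rewrite !finset.in_set mem_drop1_word.
Qed.

Lemma Pav_head_nmax (R : realType) n :
  Pav R pat123 [set s : 'S_n.+1 | head 0%N (word s) != n.+1]%SET
    = 1 - catalan R n / catalan R n.+1.
Proof.
rewrite -Pav_head_max -Pav_setC; congr Pav.
by apply/setP => s; rewrite finset.in_setC !finset.in_set.
Qed.

(** A form in which both monotonicity and limit can be read off. *)
Lemma Pav_win1E (R : realType) n :
  Pav R pat123 (win n.+1 1) = 3 / 4 - 3 / 4 * (2 * n + 1)%:R^-1.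
Proof.
rewrite Pav_win1 Pav_head_nmax catalan_ratio -addn2.
rewrite (natrD _ (4 * n)) (natrD _ (2 * n)) (natrD _ n) !natrM.
have : (0 : R) <= n%:R by [].
by move: (n%:R : R) => x x0; field; apply/andP; split; lra.
Qed.

(** Against [M = 0] the comparison is [C_(n-1) / C_n <= 1 / 2]; against larger
    [M] it is the inclusion of winning events. *)
Lemma optimal_probE (R : realType) n : (1 < n)%N ->
  optimal_prob R pat123 n = Pav R pat123 (win n 1).
Proof.
case: n => // n n0; apply/eqP; rewrite eq_le; apply/andP; split; last first.
  have n1 : (1 < n.+1)%N by [].
  exact: (le_bigmax _ (fun M : 'I_n.+1 => Pav R pat123 (win n.+1 M)) (Ordinal n1)).
apply: bigmax_le => [|[[|M] Mn] _]; first by rewrite divr_ge0.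
  rewrite /= Pav_win0 // Pav_head_max Pav_win1 Pav_head_nmax catalan_ratio.
  have : (1 : R) <= n%:R by rewrite ler1n.
  rewrite (natrD _ (4 * n)) natrM -addn2 (natrD _ n); move: (n%:R : R) => x x1.
  have: (x + 2) / (4 * x + 2) <= 1 / 2 by rewrite ler_pdivrMr; lra.
  lra.
rewrite /= !Pav_win //.
apply: le_Pav; apply/fintype.subsetP => s; rewrite !finset.in_set.
by rewrite -[M.+1]addn1 -drop_drop => /mem_drop.
Qed.

Lemma Pav_win1_incr (R : realType) m n : (m < n)%N ->
  Pav R pat123 (win m.+1 1) < Pav R pat123 (win n.+1 1).
Proof.
move=> mn; rewrite !Pav_win1E ltrD2l ltrN2 ltr_pM2l; last by lra.
by rewrite ltf_pV2 ?posrE ?ltr0n ?ltr_nat ?addn1 // ltnS ltn_pmul2l.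
Qed.

Lemma cvg_Pav_win1 (R : realType) :
  (fun n : nat => Pav R pat123 (win n 1)) @ \oo --> (3 / 4 : R).
Proof.
rewrite -cvg_shiftS; under eq_fun do rewrite /= Pav_win1E.
suff : (fun n => 3 / 4 - 3 / 4 * (2 * n + 1)%:R^-1 : R) @ \oo
    --> (3 / 4 - 3 / 4 * 0 : R) by rewrite mulr0 subr0.
apply: cvgB; first exact: cvg_cst.
apply: cvgMr; apply: (@squeeze_cvgr _ _ _ _ (cst 0) harmonic).
- apply: nearW => n /=; rewrite invr_ge0 ler0n /= lef_pV2 ?posrE ?ltr0n ?addn1 //.
  by rewrite ler_nat ltnS leq_pmull.
- exact: cvg_cst.
- exact: cvg_harmonic.
Qed.

Theorem proposition2 (R : realType) :
  (forall n : nat, (3 <= n)%N ->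
     [/\ Pav R pat123 (win n 0)
           = Pav R pat123 [set s : 'S_n | head 0%N (word s) == n]%SET,
         Pav R pat123 [set s : 'S_n | head 0%N (word s) == n]%SET
           = catalan R n.-1 / catalan R n
       & forall M : nat, (1 <= M <= n.-1)%N ->
           Pav R pat123 (win n M)
             = Pav R pat123 [set s : 'S_n | n \in drop M (word s)]%SET])
  /\ (forall n : nat, (3 <= n)%N ->
        optimal_prob R pat123 n = Pav R pat123 (win n 1))
  /\ (forall m n : nat, (3 <= m)%N -> (m < n)%N ->
        optimal_prob R pat123 m < optimal_prob R pat123 n)
  /\ (forall n : nat, (3 <= n)%N ->
        Pav R pat123 (win n 1)
          = Pav R pat123 [set s : 'S_n | head 0%N (word s) != n]%SET
        /\ Pav R pat123 [set s : 'S_n | head 0%N (word s) != n]%SET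
          = 1 - catalan R n.-1 / catalan R n)
  /\ (fun n : nat => Pav R pat123 (win n 1)) @ \oo --> (3 / 4 : R).
Proof.
split=> [[//|n] n3|].
  split; [exact: Pav_win0 | exact: Pav_head_max | move=> M /andP[M0 _]].
  exact: Pav_win.
split=> [n n3|]; first by rewrite optimal_probE // ltnW.
split=> [m n m3 mn|].
  rewrite !optimal_probE ?(ltnW m3) //; last exact: ltn_trans (ltnW m3) mn.
  case: m n m3 mn => [//|m] [//|n] _; rewrite ltnS; exact: Pav_win1_incr.
split=> [[//|n] _|]; last exact: cvg_Pav_win1.
by split; [exact: Pav_win1 | exact: Pav_head_nmax].
Qed.
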